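(* Let $\mathcal Q_1$ be the unary query on unlabelled graphs with $\mathcal Q_1(G)=\{u\in V(G):\exists v\in N_G(u)\ \deg_G(u)<\deg_G(v)\}$. Then $\mathcal Q_1$ is computable by a 2-GNN with $\mathrm{SUM}$ aggregation, but not by any 1-GNN with $\mathrm{SUM}$ aggregation whose FNNs use arbitrary activation functions that preserve fast convergence.
   Context: Graphs are finite, simple, undirected. A polynomial $\mathfrak p(X,Y)$ is nice if $\mathfrak p(X,Y)=\sum_{i=0}^k a_iX^{\lfloor i/2\rfloor}Y^{\lceil i/2\rceil}$ for some $k\in\mathbb N$ and real $a_i$, and co-nice if $\mathfrak p(Y,X)$ is nice. A function $f:\mathbb N^2\to\mathbb R$ is fast-converging to $\mathfrak p$ if for every $r\in\mathbb R$ there is $n_0$ such that for all $n\ge n_0$ and $m\in\{n-1,n+1\}$, $|f(m,n)-\mathfrak p(m,n)|\le n^{-r}$. Let $\mathcal{FC}$ ($\mathcal{FC}^{co}$) be the class of functions fast-converging to some nice (co-nice) polynomial. A function $g:\mathbb R^k\to\mathbb R$ preserves fast convergence if for all $f_1,\dots,f_k\in\mathcal{FC}$ the function $(m,n)\mapsto g(f_1(m,n),\dots,f_k(m,n))$ is in $\mathcal{FC}$, and for all $f_1,\dots,f_k\in\mathcal{FC}^{co}$ it is in $\mathcal{FC}^{co}$. An FNN is a composition of layers $\vec x\mapsto\sigma(A\vec x+\vec b)$ with rational $A,\vec b$ and activation $\sigma$ applied coordinatewise; unless stated otherwise $\sigma\in\{\mathrm{ReLU},\mathrm{id}\}$ (for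 the negative part of the claim, activations are arbitrary functions $\mathbb R\to\mathbb R$ preserving fast convergence). A 1-GNN layer is $(\mathrm{msg},\mathrm{agg},\mathrm{comb})$ with $\mathrm{msg}:\mathbb R^p\to\mathbb R^r$, $\mathrm{comb}:\mathbb R^{p+r}\to\mathbb R^q$ computed by FNNs and $\mathrm{agg}$ an aggregation ($\mathrm{SUM}$ is coordinatewise sum over a finite multiset, $\vec0$ on the empty multiset), mapping a signal $\mathcal f:V(G)\to\mathbb R^p$ to $\mathcal f'(v)=\mathrm{comb}\big(\mathcal f(v),\mathrm{agg}(\{\!\{\mathrm{msg}(\mathcal f(w)):w\in N_G(v)\}\!\})\big)$; a 2-GNN layer is the same with $\mathrm{msg}:\mathbb R^{2p}\to\mathbb R^r$ and messages $\mathrm{msg}(\mathcal f(v),\mathcal f(w))$. An $i$-GNN is a sequence of $i$-GNN layers with matching dimensions, computing the composition. Unlabelled graphs get the $0$-dimensional input signal. A GNN $\mathfrak N$ with output dimension $1$ computes $\mathcal Q$ if for all graphs $G$ and $v\in V(G)$ the output at $v$ is $\ge3/4$ if $v\in\mathcal Q(G)$ and $\le1/4$ otherwise. *)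

(* Defs.v *)
From HB Require Import structures.
From mathcomp Require Import all_boot all_order all_algebra.
From mathcomp Require Import polyXY.
From mathcomp Require Import reals exp.

Set Implicit Arguments.
Unset Strict Implicit.
Unset Printing Implicit Defensive.

Import Order.TTheory GRing.Theory Num.Theory.
Local Open Scope ring_scope.

Record sgraph := SGraph {
  vertex :> finType;
  adj : rel vertex;
  adj_sym : symmetric adj;
  adj_irrefl : irreflexive adj }.

Definition nbr (G : sgraph) (v : G) : {set G} := [set w | adj v w].
Definition deg (G : sgraph) (v : G) : nat := #|nbr v|.

Definition unary_query := forall G : sgraph, {set G}.

Definition Q1 : unary_query :=
  fun G => [set u : G | [exists v in nbr u, (deg u < deg v)%N]].

Section FastConvergence.
Variable R : realType.

Definition nice (p : {poly {poly R}}) : Prop :=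
  exists (k : nat) (a : nat -> R),
    p = \sum_(i < k.+1) (a i)%:P%:P * 'X ^+ (i./2) * 'Y ^+ (uphalf i).

Definition conice (p : {poly {poly R}}) : Prop := nice (swapXY p).

(* m.+1 = n encodes m = n - 1 without truncated subtraction *)
Definition fast_converging (f : nat -> nat -> R) (p : {poly {poly R}}) : Prop :=
  forall r : R, exists n0 : nat, forall n m : nat,
    (n0 <= n)%N -> (m.+1 = n \/ m = n.+1) ->
    `|f m n - p.[m%:R, n%:R]| <= n%:R `^ (- r).

Definition FC (f : nat -> nat -> R) : Prop :=
  exists p, nice p /\ fast_converging f p.

Definition FCco (f : nat -> nat -> R) : Prop :=
  exists p, conice p /\ fast_converging f p.

Definition preserves_fc (k : nat) (g : 'cV[R]_k -> R) : Prop :=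
  (forall f : 'I_k -> nat -> nat -> R,
     (forall i, FC (f i)) -> FC (fun m n => g (\col_i f i m n))) /\
  (forall f : 'I_k -> nat -> nat -> R,
     (forall i, FCco (f i)) -> FCco (fun m n => g (\col_i f i m n))).

(* Activations are unary, so R is identified with R^1. *)
Definition fc_activation (s : R -> R) : Prop :=
  @preserves_fc 1 (fun x => s (x 0 0)).

Definition relu (x : R) : R := Num.max 0 x.

Definition relu_or_id (s : R -> R) : Prop := s = relu \/ s = id.

End FastConvergence.

(* Nonempty sequences of layers with matching dimensions, L p q being the type
   of layers of input dimension p and output dimension q. *)
Inductive chain (L : nat -> nat -> Type) : nat -> nat -> Type :=
| Single p q : L p q -> chain L p q
| Compose p q r : L p q -> chain L q r -> chain L p r.

Fixpoint chain_eval (L : nat -> nat -> Type) (X : nat -> Type)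
    (ev : forall p q, L p q -> X p -> X q)
    p q (c : chain L p q) : X p -> X q :=
  match c in chain _ p q return X p -> X q with
  | Single _ _ l => ev _ _ l
  | Compose _ _ _ l c' => fun x => chain_eval ev c' (ev _ _ l x)
  end.

Fixpoint chain_all (L : nat -> nat -> Type)
    (P : forall p q, L p q -> Prop) p q (c : chain L p q) : Prop :=
  match c with
  | Single _ _ l => P _ _ l
  | Compose _ _ _ l c' => P _ _ l /\ chain_all P c'
  end.

Section Networks.
Variable R : realType.

Record fnn_layer (p q : nat) := FNNLayer {
  weight : 'M[rat]_(q, p);
  bias : 'cV[rat]_q;
  activation : R -> R }.

Definition fnn_layer_eval p q (l : fnn_layer p q) (x : 'cV[R]_p) : 'cV[R]_q :=
  map_mx (activation l)
    (map_mx ratr (weight l) *m x + map_mx ratr (bias l)).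

Definition fnn := chain fnn_layer.

Definition fnn_eval p q (N : fnn p q) : 'cV[R]_p -> 'cV[R]_q :=
  chain_eval (X := fun d => 'cV[R]_d) fnn_layer_eval N.

Definition fnn_over (S : (R -> R) -> Prop) p q (N : fnn p q) : Prop :=
  chain_all (fun _ _ l => S (activation l)) N.

Definition signal (G : sgraph) (p : nat) := G -> 'cV[R]_p.

(* The aggregation is fixed to SUM: summing over the neighbours w of v is
   summing over the multiset of their messages. *)
Record sum_gnn1_layer (p q : nat) := SumGNN1Layer {
  dim1 : nat;
  msg1 : fnn p dim1;
  comb1 : fnn (p + dim1) q }.

Record sum_gnn2_layer (p q : nat) := SumGNN2Layer {
  dim2 : nat;
  msg2 : fnn (p + p) dim2;
  comb2 : fnn (p + dim2) q }.

Definition sum_gnn1_layer_eval (G : sgraph) p q (l : sum_gnn1_layer p q)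
    (f : signal G p) : signal G q := fun v =>
  fnn_eval (comb1 l)
    (col_mx (f v) (\sum_(w in nbr v) fnn_eval (msg1 l) (f w))).

Definition sum_gnn2_layer_eval (G : sgraph) p q (l : sum_gnn2_layer p q)
    (f : signal G p) : signal G q := fun v =>
  fnn_eval (comb2 l)
    (col_mx (f v) (\sum_(w in nbr v) fnn_eval (msg2 l) (col_mx (f v) (f w)))).

Definition sum_gnn1 := chain sum_gnn1_layer.
Definition sum_gnn2 := chain sum_gnn2_layer.

Definition sum_gnn1_eval p q (N : sum_gnn1 p q) (G : sgraph) :
    signal G p -> signal G q :=
  chain_eval (@sum_gnn1_layer_eval G) N.

Definition sum_gnn2_eval p q (N : sum_gnn2 p q) (G : sgraph) :
    signal G p -> signal G q :=
  chain_eval (@sum_gnn2_layer_eval G) N.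

Definition sum_gnn1_over (S : (R -> R) -> Prop) p q (N : sum_gnn1 p q) : Prop :=
  chain_all (fun _ _ l => fnn_over S (msg1 l) /\ fnn_over S (comb1 l)) N.

Definition sum_gnn2_over (S : (R -> R) -> Prop) p q (N : sum_gnn2 p q) : Prop :=
  chain_all (fun _ _ l => fnn_over S (msg2 l) /\ fnn_over S (comb2 l)) N.

Definition unlabelled (G : sgraph) : signal G 0 := fun _ => 0.

Definition computes (out : forall G : sgraph, signal G 0 -> signal G 1)
    (Q : unary_query) : Prop :=
  forall (G : sgraph) (v : G),
    (v \in Q G -> 3 / 4 <= out G (@unlabelled G) v 0 0) /\
    (v \notin Q G -> out G (@unlabelled G) v 0 0 <= 1 / 4).

End Networks.

(* Main.v *)
(** On the complete bipartite graph with parts of sizes [m] and [n], the state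
    of a vertex depends only on its part. By induction on the layers, as [m]
    and [n] vary, the states on the part of size [m] (whose vertices have degree
    [n]) fast-converge to nice polynomials, and those on the other part to
    co-nice ones: activations preserve both classes, and summing over the [n]
    neighbours multiplies a co-nice polynomial by [Y], which makes it nice.
    Nice polynomials are exactly those of the form [P(XY) + Y Q(XY)].
    Substituting [X = Y + 1] and [X = Y - 1] gives univariate polynomials
    whose leading monomials agree, because [P(Y^2 +- Y)] has even degree and
    [Y Q(Y^2 +- Y)] odd degree. Applied to [P - 1/2], this shows that the two
    outputs on the part of size [m] are asymptotically on the same side of [1/2]
    for [m = n + 1] and [m = n - 1], whereas [Q1] holds there in the first case
    and fails in the second.

    With messages depending on both endpoints, one layer computes degrees and
    a second one sums [relu (deg w - deg v)] over the neighbours [w] of [v]. *)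

Require Import Defs.
From mathcomp Require Import all_boot all_order all_algebra.
From mathcomp Require Import reals.
From mathcomp Require Import polyXY polyrcf exp ring lra zify.

Set Implicit Arguments.
Unset Strict Implicit.
Unset Printing Implicit Defensive.

Import Order.TTheory GRing.Theory Num.Theory.
Local Open Scope ring_scope.

(** * Error terms decaying faster than every power of [n] along [m = n - 1] and [m = n + 1] *)

Section Negligible.
Variable R : realType.

Definition negligible (e : nat -> nat -> R) : Prop :=
  forall r : R, exists n0 : nat, forall n m : nat,
    (n0 <= n)%N -> (m.+1 = n \/ m = n.+1) -> `|e m n| <= n%:R `^ (- r).

Lemma negligible_ext e1 e2 :
  (forall m n, e1 m n = e2 m n) -> negligible e1 -> negligible e2.
Proof. by move=> E H r; have [n0 h] := H r; exists n0 => n m; rewrite -E; apply: h. Qed.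

Lemma negligible0 : negligible (fun _ _ => 0).
Proof. by move=> r; exists 0%N => n m _ _; rewrite normr0 powR_ge0. Qed.

Lemma powR_shift (n : nat) (r : R) (k : nat) : (0 < n)%N ->
  n%:R ^+ k * n%:R `^ (- (r + k%:R)) = n%:R `^ (- r).
Proof.
move=> n0; have n0' : n%:R != 0 :> R by rewrite pnatr_eq0 -lt0n.
rewrite -powR_mulrn ?ler0n // -powRD ?n0' ?implybT //.
by congr (_ `^ _); lra.
Qed.

(** The error is available at every exponent, so taking it at [r + 2] absorbs a factor of size
    [n ^ 2]. This bound covers constants as well as the factors [m] and [n]. *)
Lemma negligibleM (c e : nat -> nat -> R) (n1 : nat) :
  (forall n m, (n1 <= n)%N -> (m.+1 = n \/ m = n.+1) -> `|c m n| <= n%:R ^+ 2) ->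
  negligible e -> negligible (fun m n => c m n * e m n).
Proof.
move=> hc he r; have [n0 h] := he (r + 2%:R).
exists (maxn 1 (maxn n0 n1)) => n m; rewrite !geq_max => /and3P[n_gt0 hn0 hn1] mn.
rewrite normrM -(powR_shift r 2) //.
by apply: ler_pM; rewrite ?hc ?h.
Qed.

Lemma negligibleZ (c : R) e : negligible e -> negligible (fun m n => c * e m n).
Proof.
apply: (@negligibleM (fun _ _ => c) e (maxn 1 (Num.bound `|c|))) => n m.
rewrite geq_max => /andP[n0 nc] _.
have h1 : 1 <= n%:R :> R by rewrite ler1n.
have h2 : (Num.bound `|c|)%:R <= n%:R :> R by rewrite ler_nat.
have := archi_boundP (normr_ge0 c); nra.
Qed.

Lemma negligibleMn (b : bool) e : negligible e ->
  negligible (fun m n => (if b then n else m)%:R * e m n).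
Proof.
apply: (@negligibleM _ e 2) => n m n2 mn.
rewrite normr_nat -natrX ler_nat.
by case: b; case: mn => mn; nia.
Qed.

Lemma negligibleD e1 e2 :
  negligible e1 -> negligible e2 -> negligible (fun m n => e1 m n + e2 m n).
Proof.
move=> h1 h2 r; have [n1 {}h1] := h1 (r + 1%:R); have [n2 {}h2] := h2 (r + 1%:R).
(* From [n >= 2] on, two errors of size [n ^ - (r + 1)] add up to at most [n ^ - r]. *)
exists (maxn 2 (maxn n1 n2)) => n m; rewrite !geq_max => /and3P[n_ge2 hn1 hn2] mn.
have n2' : 2 <= n%:R :> R by rewrite ler_nat.
rewrite -(powR_shift r 1); last by lia.
have := h1 _ _ hn1 mn; have := h2 _ _ hn2 mn; have := ler_normD (e1 m n) (e2 m n).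
move: (powR_ge0 n%:R (- (r + 1%:R))); nra.
Qed.

End Negligible.

(** * Fast convergence in the normal form [P(XY) + Y Q(XY)], and its closure properties *)

Section Balanced.
Variable R : realType.

(** Values of nice polynomials for [b = true], of co-nice ones for [b = false]; the flag lets both
    cases share their proofs. *)
Definition balanced (b : bool) (P Q : {poly R}) (m n : nat) : R :=
  P.[m%:R * n%:R] + (if b then n else m)%:R * Q.[m%:R * n%:R].

Definition fast (b : bool) (f : nat -> nat -> R) : Prop :=
  exists P Q, negligible (fun m n => f m n - balanced b P Q m n).

(** With [h = i./2], the monomial of index [i] is [(XY)^h] for even [i] and [Y (XY)^h] for odd [i];
    the former go to [P], the latter to [Q]. *)
Lemma nice_balanced (p : {poly {poly R}}) : nice p ->
  exists P Q : {poly R}, forall x y, p.[x, y] = P.[x * y] + y * Q.[x * y].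
Proof.
case=> k [a ->]; elim: k.+1 => [|{}k [P [Q IH]]].
  by exists 0, 0 => x y; rewrite big_ord0 !horner0 mulr0 addr0.
exists (P + (if odd k then 0 else (a k)%:P * 'X^(k./2))),
       (Q + (if odd k then (a k)%:P * 'X^(k./2) else 0)) => x y.
rewrite big_ord_recr /= !hornerD IH uphalf_half.
have -> : ((a k)%:P%:P * 'X ^+ k./2 * 'Y ^+ (odd k + k./2)).[x, y]
  = a k * x ^+ k./2 * y ^+ (odd k + k./2).
  by rewrite -polyC_exp !hornerE.
case: (odd k); rewrite !hornerE /= ?add0n ?add1n ?exprS ?exprMn; ring.
Qed.

Lemma balanced_nice (P Q : {poly R}) :
  exists p : {poly {poly R}}, nice p /\
    forall x y, p.[x, y] = P.[x * y] + y * Q.[x * y].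
Proof.
pose N := maxn (size P) (size Q).
pose a i := if odd i then Q`_(i./2) else P`_(i./2).
exists (\sum_(i < N.*2.+2) (a i)%:P%:P * 'X ^+ (i./2) * 'Y ^+ (uphalf i)).
split=> [|x y]; first by exists N.*2.+1, a.
have [hP hQ] : (size P <= N.+1)%N /\ (size Q <= N.+1)%N.
  by rewrite /N; split; lia.
rewrite (horner_coef_wide _ hP) (horner_coef_wide _ hQ) -doubleS.
elim: N.+1 => [|k IH]; first by rewrite !big_ord0 !horner0 mulr0 addr0.
rewrite doubleS !big_ord_recr /= !hornerD IH !uphalf_half /a /= !odd_double.
rewrite !doubleK uphalf_double /= ?add0n ?add1n -!polyC_exp !hornerE !exprMn ?exprS.
ring.
Qed.

Lemma FC_fast (f : nat -> nat -> R) : FC f <-> fast true f.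
Proof.
split=> [[p [/nice_balanced[P [Q E]] h]]|[P [Q h]]].
  by exists P, Q; apply: negligible_ext h => m n; rewrite E.
have [p [np E]] := balanced_nice P Q.
by exists p; split=> //; apply: negligible_ext h => m n; rewrite E.
Qed.

Lemma FCco_fast (f : nat -> nat -> R) : FCco f <-> fast false f.
Proof.
split=> [[p [/nice_balanced[P [Q E]] h]]|[P [Q h]]].
  exists P, Q; apply: negligible_ext h => m n.
  by rewrite -horner2_swapXY E /balanced mulrC.
have [p [np E]] := balanced_nice P Q.
exists (swapXY p); split; first by rewrite /conice swapXYK.
by apply: negligible_ext h => m n; rewrite horner2_swapXY E /balanced mulrC.
Qed.

Lemma fast_ext b f1 f2 : (forall m n, f1 m n = f2 m n) -> fast b f1 -> fast b f2.
Proof.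
move=> E [P [Q h]]; exists P, Q.
by apply: negligible_ext h => m n; rewrite E.
Qed.

Lemma fast_const b c : fast b (fun _ _ => c).
Proof.
exists c%:P, 0; apply: negligible_ext (@negligible0 R) => m n.
by rewrite /balanced !hornerE ?mulr0 ?addr0 subrr.
Qed.

Lemma fastD b f1 f2 : fast b f1 -> fast b f2 -> fast b (fun m n => f1 m n + f2 m n).
Proof.
move=> [P1 [Q1 h1]] [P2 [Q2 h2]]; exists (P1 + P2), (Q1 + Q2).
apply: negligible_ext (negligibleD h1 h2) => m n.
by rewrite /balanced !hornerD; ring.
Qed.

Lemma fastZ b c f : fast b f -> fast b (fun m n => c * f m n).
Proof.
move=> [P [Q h]]; exists (c *: P), (c *: Q).
apply: negligible_ext (negligibleZ c h) => m n.
by rewrite /balanced !hornerZ; ring.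
Qed.

Lemma fast_sum b (I : finType) (f : I -> nat -> nat -> R) :
  (forall i, fast b (f i)) -> fast b (fun m n => \sum_i f i m n).
Proof.
move=> h; elim: (index_enum I) => [|i s IH].
  by apply: fast_ext (fast_const b 0) => m n; rewrite big_nil.
by apply: fast_ext (fastD (h i) IH) => m n; rewrite big_cons.
Qed.

(** For [b = true], [n (P + m Q) = (mn) Q + n P]: the two polynomials swap roles and [Q] gains a
    factor [XY]. *)
Lemma fast_natM b f : fast (~~ b) f ->
  fast b (fun m n => (if b then n else m)%:R * f m n).
Proof.
move=> [P [Q h]]; exists ('X * Q), P.
apply: negligible_ext (negligibleMn b h) => m n.
by rewrite /balanced hornerM hornerX; case: b {h} => /=; ring.
Qed.

Lemma fast_activation b s f : fc_activation s -> fast b f ->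
  fast b (fun m n => s (f m n)).
Proof.
move=> [hs hs'] hf.
have E m n : s ((\col_(i < 1) f m n) 0 0) = s (f m n) by rewrite mxE.
apply: (fast_ext E); case: b hf => hf.
  by apply/FC_fast; apply: (hs (fun=> f)) => _; apply/FC_fast.
by apply/FCco_fast; apply: (hs' (fun=> f)) => _; apply/FCco_fast.
Qed.

(** Each class is a vector space containing the constants, so affine maps preserve it; activations
    do by hypothesis. *)
Lemma fast_fnn b p q (N : fnn R p q) (g : nat -> nat -> 'cV[R]_p) :
  fnn_over (@fc_activation R) N ->
  (forall i, fast b (fun m n => g m n i 0)) ->
  forall i, fast b (fun m n => fnn_eval N (g m n) i 0).
Proof.
have layer p' q' (l : fnn_layer R p' q') (g' : nat -> nat -> 'cV[R]_p') :
    fc_activation (activation l) ->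
    (forall i, fast b (fun m n => g' m n i 0)) ->
    forall i, fast b (fun m n => fnn_layer_eval l (g' m n) i 0).
  move=> hs hg i.
  have E m n : activation l (\sum_j (ratr (weight l i j) * g' m n j 0)
      + ratr (bias l i 0)) = fnn_layer_eval l (g' m n) i 0.
    rewrite /fnn_layer_eval !mxE; congr (activation l (_ + _)).
    by apply: eq_bigr => j _; rewrite !mxE.
  apply: (fast_ext E); apply: fast_activation => //.
  apply: fastD (fast_const _ _); apply: fast_sum => j.
  exact: fastZ.
elim: N g => [p' q' l|p' q' r l N IH] g /=; first exact: layer.
by case=> hl hN hg; apply: IH => //; apply: layer.
Qed.

End Balanced.

(** * Complete bipartite graphs *)

Section Biclique.
Variables m n : nat.

Definition biclique_adj : rel ('I_m + 'I_n) := fun x y =>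
  match x, y with inl _, inr _ | inr _, inl _ => true | _, _ => false end.

Lemma biclique_adj_sym : symmetric biclique_adj.
Proof. by case=> ? []. Qed.

Lemma biclique_adj_irrefl : irreflexive biclique_adj.
Proof. by case. Qed.

Definition biclique : sgraph := SGraph biclique_adj_sym biclique_adj_irrefl.

Lemma sum_nbr_inl (V : nmodType) (F : biclique -> V) (u : 'I_m) :
  \sum_(w in nbr (inl u : biclique)) F w = \sum_(v < n) F (inr v).
Proof.
rewrite big_sumType /= big_pred0 ?add0r => [|i]; last by rewrite inE.
by apply: eq_bigl => i; rewrite inE.
Qed.

Lemma sum_nbr_inr (V : nmodType) (F : biclique -> V) (v : 'I_n) :
  \sum_(w in nbr (inr v : biclique)) F w = \sum_(u < m) F (inl u).
Proof.
rewrite big_sumType /= [X in _ + X]big_pred0 ?addr0 => [|i]; last by rewrite inE.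
by apply: eq_bigl => i; rewrite inE.
Qed.

Lemma deg_inl (u : 'I_m) : deg (inl u : biclique) = n.
Proof.
by rewrite /deg -sum1_card (sum_nbr_inl (fun=> 1%N)) sum1_card card_ord.
Qed.

Lemma deg_inr (v : 'I_n) : deg (inr v : biclique) = m.
Proof.
by rewrite /deg -sum1_card (sum_nbr_inr (fun=> 1%N)) sum1_card card_ord.
Qed.

(** The vertex has degree [n] and its neighbours have degree [m]; [0 < n] guarantees a neighbour. *)
Lemma Q1_inl (u : 'I_m) :
  ((inl u : biclique) \in Q1 biclique) = (0 < n < m)%N.
Proof.
rewrite inE; apply/existsP/andP => [[[w|w] /andP[]]|[n0 nm]].
- by rewrite inE.
- by rewrite deg_inl deg_inr => _ ->; case: n w => // -[].
by exists (inr (Ordinal n0)); rewrite inE deg_inl deg_inr.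
Qed.

End Biclique.

(** * 1-GNNs on complete bipartite graphs preserve fast convergence *)

Section LowerBound.
Variable R : realType.

Definition fast_signals p (F : forall m n, signal R (biclique m n) p) : Prop :=
  exists g h : nat -> nat -> 'cV[R]_p,
    [/\ forall m n u, F m n (inl u) = g m n,
        forall m n v, F m n (inr v) = h m n,
        forall i, fast true (fun m n => g m n i 0) &
        forall i, fast false (fun m n => h m n i 0)].

Lemma fast_comb b p q r (msg : fnn R p r) (comb : fnn R (p + r) q)
    (g h : nat -> nat -> 'cV[R]_p) :
  fnn_over (@fc_activation R) msg -> fnn_over (@fc_activation R) comb ->
  (forall i, fast b (fun m n => g m n i 0)) ->
  (forall i, fast (~~ b) (fun m n => h m n i 0)) ->
  forall i, fast b (fun m n =>
    fnn_eval comb (col_mx (g m n)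
      (fnn_eval msg (h m n) *+ (if b then n else m))) i 0).
Proof.
move=> hm hc hg hh; apply: fast_fnn => // i.
case: (split_ordP i) => j ->.
  by apply: fast_ext (hg j) => m n; rewrite col_mxEu.
apply: fast_ext (fast_natM (fast_fnn hm hh j)) => m n.
by rewrite col_mxEd mulmxnE mulr_natl.
Qed.

Lemma fast_gnn1 p q (N : sum_gnn1 R p q) F :
  sum_gnn1_over (@fc_activation R) N -> fast_signals F ->
  fast_signals (fun m n => sum_gnn1_eval N (F m n)).
Proof.
have layer p' q' (l : sum_gnn1_layer R p' q') F' :
    fnn_over (@fc_activation R) (msg1 l) /\ fnn_over (@fc_activation R) (comb1 l) ->
    fast_signals F' ->
    fast_signals (fun m n => sum_gnn1_layer_eval l (F' m n)).
  move=> [hm hc] [g [h [Eg Eh hg hh]]].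
  exists (fun m n => fnn_eval (comb1 l) (col_mx (g m n) (fnn_eval (msg1 l) (h m n) *+ n))).
  exists (fun m n => fnn_eval (comb1 l) (col_mx (h m n) (fnn_eval (msg1 l) (g m n) *+ m))).
  split=> [m n u|m n v||].
  - rewrite /sum_gnn1_layer_eval Eg sum_nbr_inl.
    by under eq_bigr do rewrite Eh; rewrite sumr_const card_ord.
  - rewrite /sum_gnn1_layer_eval Eh sum_nbr_inr.
    by under eq_bigr do rewrite Eg; rewrite sumr_const card_ord.
  - exact: (@fast_comb true).
  - exact: (@fast_comb false).
elim: N F => [p' q' l|p' q' r l N IH] F /=; first exact: layer.
by case=> hl hN hF; apply: (IH (fun m n => sum_gnn1_layer_eval l (F m n))) => //; apply: layer.
Qed.

(** * Signs of nice polynomials along [m = n + 1] and [m = n - 1] *)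

Definition subst_poly (P Q q : {poly R}) : {poly R} := P \Po q + 'X * (Q \Po q).

(** For nonzero [P] and [Q] the summands have degrees [2 deg P] and [2 deg Q + 1], of different
    parity, so leading terms cannot cancel. The result does not depend on [q]. *)
Lemma lead_coef_subst_poly (P Q q : {poly R}) : q \is monic -> size q = 3%N ->
  lead_coef (subst_poly P Q q) =
  if (size Q < size P)%N then lead_coef P else lead_coef Q.
Proof.
move=> mq sq.
have lc (S : {poly R}) : lead_coef (S \Po q) = lead_coef S.
  by rewrite lead_coef_comp ?sq // (monicP mq) expr1n mulr1.
have sz (S : {poly R}) : (size (S \Po q)).-1 = ((size S).-1 * 2)%N.
  by rewrite size_comp_poly sq.
have z (S : {poly R}) : (size (S \Po q) == 0%N) = (size S == 0%N).
  by rewrite !size_poly_eq0 -!lead_coef_eq0 lc.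
have szX : size ('X * (Q \Po q)) = if Q == 0 then 0%N else (size (Q \Po q)).+1.
  case: eqP => [->|/eqP Q0]; first by rewrite comp_poly0 mulr0 size_poly0.
  by rewrite mulrC size_mulX // -lead_coef_eq0 lc lead_coef_eq0.
have lcX : lead_coef ('X * (Q \Po q)) = lead_coef Q.
  by rewrite mulrC lead_coefMX lc.
rewrite /subst_poly; move: (sz P) (sz Q) (z P) (z Q) szX.
rewrite -size_poly_eq0 => sP sQ zP zQ szX.
case: ifP => hlt.
  by rewrite lead_coefDl ?lc // szX; case: ifP; lia.
case: (eqVneq (size Q) 0%N) => [Q0|Q0]; last first.
  by rewrite addrC lead_coefDl ?lcX // szX (negbTE Q0); lia.
have /eqP : size P == 0%N by lia.
move: Q0 => /eqP; rewrite size_poly_eq0 => /eqP -> /eqP; rewrite size_poly_eq0 => /eqP ->.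
by rewrite !comp_poly0 mulr0 addr0.
Qed.

Lemma size_quadratic (c : R) : size ('X^2 + c *: 'X) = 3%N.
Proof.
rewrite size_polyDl ?size_polyXn //.
by apply: leq_ltn_trans (size_scale_leq _ _) _; rewrite size_polyX.
Qed.

Lemma monic_quadratic (c : R) : 'X^2 + c *: 'X \is monic.
Proof.
rewrite monicE lead_coefDl ?lead_coefXn // size_polyXn.
by apply: leq_ltn_trans (size_scale_leq _ _) _; rewrite size_polyX.
Qed.

Lemma eventually_sign (p : {poly R}) : lead_coef p != 0 ->
  exists n0 : nat, forall n, (n0 <= n)%N -> Num.sg p.[n%:R] = Num.sg (lead_coef p).
Proof.
wlog hp : p / 0 < lead_coef p => [hwlog|] p0.
  case: (ltrgtP (lead_coef p) 0) p0 => // hp _; last first.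
    by apply: hwlog; rewrite // gt_eqF.
  have [||n0 h] := hwlog (- p); rewrite ?lead_coefN ?oppr_gt0 ?oppr_eq0 ?lt_eqF //.
  exists n0 => n /h; rewrite lead_coefN hornerN !sgrN => /oppr_inj; exact.
have [x hx] := poly_pinfty_gt_lc hp.
exists (Num.bound `|x|) => n hn.
rewrite (gtr0_sg hp) gtr0_sg //; apply: lt_le_trans hp (hx _ _).
apply: le_trans (ler_norm x) _; apply: le_trans (ltW (archi_boundP (normr_ge0 x))) _.
by rewrite ler_nat.
Qed.

Lemma fast_no_jump (f : nat -> nat -> R) : fast true f ->
  ~ (forall n, (1 < n)%N -> 3 / 4 <= f n.+1 n /\ f n.-1 n <= 1 / 4).
Proof.
move=> [P [Q hf]] H.
(* Exponent 1 suffices: for [n >= 8] the error is at most 1/8, less than the distance 1/4 from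
   either threshold to 1/2. *)
have [n1 {}hf] := hf 1.
(* At [n] this is the limit polynomial minus 1/2 for [m = n + c], because [mn = n ^ 2 + c n]. *)
pose A c := subst_poly (P - (1 / 2)%:P) Q ('X^2 + c *: 'X).
have lcA c : lead_coef (A c) = lead_coef (A 1).
  by rewrite !lead_coef_subst_poly ?size_quadratic ?monic_quadratic.
have AE c (m n : nat) : m%:R = n%:R + c -> (A c).[n%:R] = balanced true P Q m n - 1 / 2.
  move=> mE; rewrite /A /subst_poly /balanced !hornerE !horner_comp !hornerE mE.
  by rewrite (_ : n%:R ^+ 2 + c * n%:R = (n%:R + c) * n%:R); ring.
have far n : (maxn 8 n1 <= n)%N -> 0 < (A 1).[n%:R] /\ (A (- 1)).[n%:R] < 0.
  rewrite geq_max => /andP[n8 nn1].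
  have inv : n%:R `^ (- 1) <= 1 / 8 :> R.
    rewrite powR_inv1 ?ler0n // div1r lef_pV2 ?posrE ?ltr0n ?ler_nat //; lia.
  have n1' : (1 < n)%N by lia.
  have [h1 h2] := H n n1'.
  have hp : `|f n.+1 n - balanced true P Q n.+1 n| <= n%:R `^ (- 1).
    by apply: hf => //; right.
  have hm : `|f n.-1 n - balanced true P Q n.-1 n| <= n%:R `^ (- 1).
    by apply: hf => //; left; lia.
  rewrite (AE 1 n.+1) ?natr1 // (AE (- 1) n.-1); last first.
    by rewrite -[in RHS](@prednK n) ?natr1 -?natr1 ?addrK //; lia.
  by move: hp hm; rewrite !ler_norml => /andP[? ?] /andP[? ?]; split; lra.
case: (eqVneq (lead_coef (A 1)) 0) => [/eqP|A0].
  rewrite lead_coef_eq0 => /eqP A0.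
  by have [] := far _ (leqnn _); rewrite A0 horner0 ltxx.
have [n2 s1] := eventually_sign A0.
have [|n3 s2] := @eventually_sign (A (- 1)); first by rewrite lcA.
pose n := maxn (maxn 8 n1) (maxn n2 n3).
have [|a b] := far n; first by rewrite /n; lia.
(* Both values have the sign of the common leading coefficient, yet one is positive and the other
   negative. *)
have := s1 n; have := s2 n; rewrite lcA (gtr0_sg a) (ltr0_sg b) => <- //; last by rewrite /n; lia.
have le2 : (n2 <= n)%N by rewrite /n; lia.
by move/(_ le2); lra.
Qed.

Lemma Q1_not_gnn1 (N : sum_gnn1 R 0 1) :
  sum_gnn1_over (@fc_activation R) N -> ~ computes (sum_gnn1_eval N) Q1.
Proof.
move=> hN hQ.
have h0 : fast_signals (fun m n => @unlabelled R (biclique m n)).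
  by exists (fun _ _ => 0), (fun _ _ => 0); split => // -[].
have [g [h [Eg _ hg _]]] := fast_gnn1 hN h0.
apply: (fast_no_jump (hg 0)) => n n1; split.
  have [+ _] := hQ (biclique n.+1 n) (inl ord0).
  by rewrite Q1_inl Eg; apply; lia.
have n0 : (0 < n.-1)%N by lia.
have [_] := hQ (biclique n.-1 n) (inl (Ordinal n0)).
by rewrite Q1_inl Eg; apply; lia.
Qed.

End LowerBound.

(** * A two-layer 2-GNN for the query *)

Section UpperBound.
Variable R : realType.

Definition affine_net p q (A : 'M[rat]_(q, p)) (b : 'cV[rat]_q) (s : R -> R) :
  fnn R p q := Single (FNNLayer A b s).

Definition degree_layer : sum_gnn2_layer R 0 1 :=
  SumGNN2Layer (affine_net (0 : 'M_(1, 0 + 0)) (const_mx 1) id)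
               (affine_net (row_mx 0 1%:M : 'M_(1, 0 + 1)) 0 id).

(** The weights [-1, 1] act on the pair of states of [v] and [w], giving the message
    [relu (f w - f v)]; the combination keeps only the sum. *)
Definition excess_layer : sum_gnn2_layer R 1 1 :=
  SumGNN2Layer (affine_net (row_mx (- 1%:M) 1%:M : 'M_(1, 1 + 1)) 0 (@relu R))
               (affine_net (row_mx 0 1%:M : 'M_(1, 1 + 1)) 0 id).

Lemma degree_layerE (G : sgraph) (f : signal R G 0) (v : G) :
  sum_gnn2_layer_eval degree_layer f v = const_mx (deg v)%:R.
Proof.
apply/matrixP => i j; rewrite !ord1.
rewrite /sum_gnn2_layer_eval /= /fnn_eval /= /fnn_layer_eval /=.
rewrite map_row_mx !map_mx0 map_mx1 mul_row_col mul0mx mul1mx !addr0 add0r.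
rewrite !mxE summxE /deg.
under eq_bigr do rewrite mul0mx add0r !mxE rmorph1.
by rewrite sumr_const.
Qed.

Lemma excess_layerE (G : sgraph) (f : signal R G 1) (v : G) :
  sum_gnn2_layer_eval excess_layer f v 0 0 =
  \sum_(w in nbr v) relu (f w 0 0 - f v 0 0).
Proof.
rewrite /sum_gnn2_layer_eval /= /fnn_eval /= /fnn_layer_eval /=.
rewrite map_row_mx !map_mx0 map_mx1 mul_row_col mul0mx mul1mx !addr0 add0r.
rewrite !mxE summxE; apply: eq_bigr => w _.
rewrite map_row_mx map_mxN map_mx1 mul_row_col mulNmx !mul1mx addr0 !mxE.
by rewrite addrC.
Qed.

Lemma Q1_gnn2 : exists N : sum_gnn2 R 0 1,
  sum_gnn2_over (@relu_or_id R) N /\ computes (sum_gnn2_eval N) Q1.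
Proof.
exists (Compose degree_layer (Single excess_layer)); split.
  by split; split; [right | right | left | right].
move=> G v; rewrite /sum_gnn2_eval /= excess_layerE.
under eq_bigr do rewrite !degree_layerE !mxE.
have relu_ge0 (x : R) : 0 <= relu x by rewrite /relu le_max lexx.
split; rewrite inE.
  case/existsP => w /andP[vw lt_vw].
  (* Degrees are integers, so the neighbour [w] of larger degree alone contributes at least 1. *)
  rewrite (bigD1 w) //=; apply: (@le_trans _ _ 1); first by lra.
  apply: ler_wpDr; first exact: sumr_ge0.
  by rewrite /relu le_max lerBrDr nat1r ler_nat lt_vw orbT.
move/existsPn => h; rewrite big1 ?divr_ge0 // => w vw.
move: (h w); rewrite vw /= -leqNgt => le_wv.
by apply/max_idPl; rewrite subr_le0 ler_nat.
Qed.

End UpperBound.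

Theorem theorem5p7 (R : realType) :
  (exists N : sum_gnn2 R 0 1,
     sum_gnn2_over (@relu_or_id R) N /\ computes (sum_gnn2_eval N) Q1) /\
  ~ (exists N : sum_gnn1 R 0 1,
       sum_gnn1_over (@fc_activation R) N /\ computes (sum_gnn1_eval N) Q1).
Proof.
split; first exact: Q1_gnn2.
by case=> N [hN]; apply: Q1_not_gnn1.
Qed.
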